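(* There exists a function $g:\mathbb{R}_+\to\mathbb{R}_+$, where $\mathbb{R}_+=[0,\infty)$, such that for any two i.i.d. $\mathbb{Z}$-valued random variables $X,X'$ with common probability distribution $p$ of finite entropy, $$H(p\star p)-H(p)\ \geq\ g(H(p)).$$ Moreover, $g$ is an increasing function, $\lim_{c\to\infty}g(c)=\frac{1}{8}\log_2(e)$, and $g(c)=0$ if and only if $c=0$.
   Context: For a probability distribution $p$ on $\mathbb{Z}$, $H(p)=-\sum_{i\in\mathbb{Z}}p(i)\log_2 p(i)$ is the Shannon entropy in bits (with $0\log_2 0=0$). $p\star q$ denotes convolution, $(p\star q)(i)=\sum_{j\in\mathbb{Z}}p(j)q(i-j)$, i.e. the distribution of the sum of independent random variables with distributions $p$ and $q$; thus $H(p\star p)=H(X+X')$. ''Increasing'' is meant in the monotone sense: $c\le c'$ implies $g(c)\le g(c')$. The function $g$ is universal: it does not depend on $p$. *)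

(* Defs.v *)
From HB Require Import structures.
From mathcomp Require Import all_boot all_order all_algebra.
From mathcomp Require Import all_classical all_reals all_analysis.
Set Implicit Arguments.
Unset Strict Implicit.
Unset Printing Implicit Defensive.
Import Order.TTheory GRing.Theory Num.Theory.
Import numFieldNormedType.Exports.
Local Open Scope classical_set_scope.
Local Open Scope ring_scope.

HB.instance Definition _ := isPointed.Build int 0.

HB.instance Definition _ := @isMeasurable.Build default_measure_display
  int discrete_measurable discrete_measurable0
  discrete_measurableC discrete_measurableU.

Definition independent_RVs (d d1 d2 : measure_display) (T : measurableType d)
    (T1 : measurableType d1) (T2 : measurableType d2) (R : realType)
    (P : probability T R) (X : {RV P >-> T1}) (Y : {RV P >-> T2}) : Prop :=
  forall (A : set T1) (B : set T2), measurable A -> measurable B ->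
    P (X @^-1` A `&` Y @^-1` B) = (P (X @^-1` A) * P (Y @^-1` B))%E.

(* A probability distribution on the discrete space [int] is represented by its
   mass function. *)
Definition has_distribution (d : measure_display) (T : measurableType d)
    (R : realType) (P : probability T R) (X : {RV P >-> int})
    (p : int -> R) : Prop :=
  forall i : int, distribution P X [set i] = (p i)%:E.

Definition log2 (R : realType) (x : R) : R := ln x / ln 2.

(* [\esum] sums nonnegative families: for a mass function [p] every term
   [- (p i * log2 (p i))] is nonnegative, and it is 0 when [p i = 0]. *)
Definition entropy (R : realType) (p : int -> R) : \bar R :=
  (\esum_(i in [set: int]) (- (p i * log2 (p i)))%:E)%E.

Definition convolution (R : realType) (p q : int -> R) : int -> R :=
  fun i => fine (\esum_(j in [set: int]) (p j * q (i - j))%:E)%E.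

Notation "p ⋆ q" := (convolution p q) (at level 40, left associativity)
  : ring_scope.

(* Main.v *)
Require Import Defs.
From HB Require Import structures.
From mathcomp Require Import all_boot all_order all_algebra.
From mathcomp Require Import all_classical all_reals all_analysis.
From mathcomp Require Import ring lra zify.
Set Implicit Arguments.
Unset Strict Implicit.
Unset Printing Implicit Defensive.
Import Order.TTheory GRing.Theory Num.Theory.
Import numFieldNormedType.Exports.
Local Open Scope classical_set_scope.
Local Open Scope ring_scope.

(** Let x be the mass p(m) of a median m. The entropy gain H(X + X') - H(X) is
    bounded below in two ways, in nats, for H(X) = h.

    - Conditioning X + X' on whether X' = m gives a gain of at least
      x h - H_b(x), with H_b the binary entropy; it is large when x stays away
      from 0 and h is large. With t = sqrt (1 - x), H_b(x) <= 3 t.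

    - Let sigma be the sign of m - X', with the value s at X' = m chosen so that
      E sigma = 0, and tau the sign of 2m - (X + X'), with the same value s at 0.
      The gain is the mutual information of X' and X + X', hence, by Gibbs'
      inequality against the density 1 + d sigma tau (whose mean is 1 under the
      product law since E sigma = 0), at least E ln (1 + d sigma tau). Since the
      correlation E (sigma tau) is at least d = (1 - x^2) / 2, this is at least
      d^2 / 2 >= t^4 / 8.

    For t0 = h / (h + 4), the first bound is at least t0 when t <= t0 and the
    second is at least t0^4 / 8 when t >= t0, so g can be t0^4 / 8, converted to
    bits. *)

(** * Elementary inequalities for the logarithm *)

Section logarithm.
Variable R : realType.
Implicit Types x u v w s t d : R.

Lemma ln_le_subr1 x : 0 < x -> ln x <= x - 1.
Proof.
move=> x0; rewrite -[X in ln X](subrKC 1); apply: le_ln1Dx.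
by rewrite ltrBrDl subrr.
Qed.

(** Termwise Gibbs' inequality: [ln_le_subr1] at [v / u], scaled by [u]. The summands [u] and [v]
    sum to total masses, which cancel in the applications. *)
Lemma xlnx_le u v : 0 <= u -> 0 < v -> - (u * ln u) + u <= u * (- ln v) + v.
Proof.
rewrite le_eqVlt => /predU1P[<- v0|u0 v0]; first by lra.
have : u * ln (v / u) <= u * (v / u - 1).
  by rewrite ler_pM2l//; apply: ln_le_subr1; rewrite divr_gt0.
rewrite ln_div ?posrE// mulrBr mulrBr mulrCA divff ?gt_eqF// => h.
by lra.
Qed.

Lemma is_derive_ln1D c x : 0 < 1 + c * x ->
  is_derive x 1 (fun x => ln (1 + c * x)) (c / (1 + c * x)).
Proof.
move=> cx0.
have h : is_derive x 1 (fun x : R => 1 + c * x) c.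
  have : is_derive x 1 (cst 1 + (c *: id) : R -> R) (0 + c *: 1).
    exact: is_deriveD.
  by rewrite add0r /GRing.scale/= mulr1.
rewrite mulrC.
exact: (@is_derive1_comp R (@ln R) (fun x => 1 + c * x) x _ _
  (is_derive1_ln cx0) h).
Qed.

Lemma ger0_is_derive_le (f df : R -> R) (b : R) : 0 <= b ->
  (forall x, 0 <= x <= b -> is_derive x 1 f (df x)) ->
  (forall x, 0 < x < b -> 0 <= df x) -> f 0 <= f b.
Proof.
rewrite le_eqVlt => /predU1P[<-//|b0] fdf df0.
have cf : {within `[0, b], continuous f}.
  apply: derivable_within_continuous => x; rewrite in_itv/= => /fdf h.
  exact: ex_derive.
have [x|c] := @MVT R f df 0 b b0 _ cf.
  rewrite in_itv/= => /andP[x0 xb]; apply: fdf.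
  by rewrite !ltW.
rewrite in_itv/= => cb e.
by rewrite -subr_ge0 e subr0 mulr_ge0// ?df0// ltW.
Qed.

(** The difference of the two sides vanishes at 0 and has derivative [2 x^2 / (1 - x^2)]. *)
Lemma ln1D_ln1B_ge d : 0 <= d -> d < 1 -> 2 * d <= ln (1 + d) - ln (1 - d).
Proof.
move=> d0 d1.
pose f x := ln (1 + 1 * x) - ln (1 + (-1) * x) - 2 * x.
suff : f 0 <= f d.
  by rewrite /f !mulr0 !addr0 ln1 !mul1r mulN1r; lra.
apply: (ger0_is_derive_le (df := fun x =>
   1 / (1 + 1 * x) - (-1) / (1 + (-1) * x) - 2)) => // x /andP[x0 xd].
  have h1 : is_derive x 1 _ _ := @is_derive_ln1D 1 x _.
  have {}h1 := h1 ltac:(lra).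
  have h2 : is_derive x 1 _ _ := @is_derive_ln1D (-1) x _.
  have {}h2 := h2 ltac:(lra).
  apply: (@is_derive_eq _ _ _ _ _ _ _ _
    (is_deriveB (is_deriveB h1 h2) (is_deriveZ 2 (is_derive_id x 1)))).
  by rewrite /GRing.scale/= mulr1.
have -> : 1 / (1 + 1 * x) - (-1) / (1 + (-1) * x) - 2
   = 2 * x ^+ 2 / ((1 + x) * (1 - x)).
  field; apply/andP; split; apply/eqP; lra.
by rewrite divr_ge0// ?mulr_ge0 ?sqr_ge0//; lra.
Qed.

(** The right-hand side is twice the divergence of a coin of bias [d] from a fair one. The
    derivative of the difference is nonnegative by [ln1D_ln1B_ge]. *)
Lemma binary_entropy_quadratic d : 0 <= d -> d < 1 ->
  d ^+ 2 <= (1 + d) * ln (1 + d) + (1 - d) * ln (1 - d).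
Proof.
move=> d0 d1.
pose f x := (1 + x) * ln (1 + 1 * x) + (1 - x) * ln (1 + (-1) * x) - x ^+ 2.
suff : f 0 <= f d.
  rewrite /f !mulr0 !addr0 ln1 !mul1r mulN1r expr0n/=; lra.
apply: (ger0_is_derive_le (df := fun x =>
   ln (1 + x) - ln (1 - x) - 2 * x)) => // x /andP[x0 xd].
  have h1 : is_derive x 1 _ _ := @is_derive_ln1D 1 x _.
  have {}h1 := h1 ltac:(lra).
  have h2 : is_derive x 1 _ _ := @is_derive_ln1D (-1) x _.
  have {}h2 := h2 ltac:(lra).
  have h : is_derive x 1 ((cst 1 + id) * (fun x => ln (1 + 1 * x))
      + (cst 1 - id) * (fun x => ln (1 + (-1) * x)) - id ^+ 2 : R -> R)
      (ln (1 + 1 * x) - ln (1 + (-1) * x) - 2 * x).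
    apply: is_derive_eq; rewrite /GRing.scale/=.
    change ((1 + x) * (1 / (1 + 1 * x)) + ln (1 + 1 * x) * (0 + 1) +
      ((1 - x) * (-1 / (1 + -1 * x)) + ln (1 + -1 * x) * (0 - 1)) -
      2 * x ^+ 1 * 1 = ln (1 + 1 * x) - ln (1 + (-1) * x) - 2 * x).
    field; apply/andP; split; apply/eqP; lra.
  by rewrite mul1r mulN1r in h.
by rewrite subr_ge0 ln1D_ln1B_ge//; lra.
Qed.

(* Gibbs' inequality for the weight [1 + d s], with its logarithm replaced by the
   chord between [s = -1] and [s = 1], which is affine in [s]. *)
Lemma ln_chord_le d s u v : 0 <= d -> d < 1 -> -1 <= s <= 1 -> 0 <= u -> 0 < v ->
  - (u * ln u) + u <=
  u * - ln v - u * ((1 + s) / 2 * ln (1 + d) + (1 - s) / 2 * ln (1 - d))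
  + v * (1 + d * s).
Proof.
move=> d0 d1 /andP[s0 s1] u0 v0.
have hp : 0 < v * (1 + d) by rewrite mulr_gt0//; lra.
have hm : 0 < v * (1 - d) by rewrite mulr_gt0//; lra.
(* The instances at [v (1 + d)] and [v (1 - d)] are averaged with weights [(1 + s) / 2] and
   [(1 - s) / 2]; the average of the two values is [v (1 + d s)]. *)
have := xlnx_le u0 hp; have := xlnx_le u0 hm.
rewrite !lnM ?posrE; try lra.
move=> h1 h2.
have := ler_wpM2l (_ : 0 <= (1 + s) / 2) h2.
have := ler_wpM2l (_ : 0 <= (1 - s) / 2) h1.
move=> /(_ ltac:(lra)) h3 /(_ ltac:(lra)) h4.
have := lerD h3 h4; set a := ln (1 + d); set b := ln (1 - d); set c := ln v.
set e := ln u; move=> h; rewrite -subr_ge0; move: h; rewrite -subr_ge0.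
by congr (0 <= _); field.
Qed.

Lemma xlnx_ge0 x : 0 <= x <= 1 -> 0 <= - (x * ln x).
Proof. by move=> /andP[x0 x1]; rewrite -mulrN mulr_ge0// oppr_ge0 ln_le0. Qed.

Lemma xlnx_le_1B x : 0 <= x -> - (x * ln x) <= 1 - x.
Proof.
rewrite le_eqVlt => /predU1P[<-|x0]; first by lra.
have := @xlnx_le x 1 (ltW x0) ltr01; rewrite ln1; lra.
Qed.

(** The left-hand side is [2 t] times [- (t ln t)], and the latter is at most [1 - t]. *)
Lemma xlnx_sqr_le t : 0 <= t -> - (t ^+ 2 * ln (t ^+ 2)) <= 2 * t.
Proof.
rewrite le_eqVlt => /predU1P[<-|t0]; first by rewrite expr0n/=; lra.
have := xlnx_le_1B (ltW t0); rewrite lnXn// mulr2n => h.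
have := ler_wpM2l (ltW t0) h => {}h.
have := sqr_ge0 t; rewrite expr2 in h *; lra.
Qed.

Lemma binary_entropy_le x t : 0 <= x -> 0 <= t <= 1 -> t ^+ 2 = 1 - x ->
  - (x * ln x) - (1 - x) * ln (1 - x) <= 3 * t.
Proof.
move=> x0 /andP[t0 t1] tx; rewrite -tx.
have := xlnx_sqr_le t0; have := xlnx_le_1B x0; rewrite -tx.
have : t ^+ 2 <= t by rewrite expr2 ler_piMr.
lra.
Qed.

End logarithm.

(** * Rearrangement of nonnegative sums *)

Section nonnegative_sums.
Variable R : realType.

Lemma esumZl (T : choiceType) (c : R) (f : T -> \bar R) :
  0 <= c -> (forall i, (0 <= f i)%E) ->
  (\esum_(i in [set: T]) (c%:E * f i) = c%:E * \esum_(i in [set: T]) f i)%E.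
Proof.
move=> c0 f0; rewrite /esum -ereal_supZl//; last first.
  by apply/set0P; exists (\sum_(x \in set0) f x)%E; exists set0.
rewrite image_comp; congr ereal_sup; apply: eq_imagel => A _ /=.
by rewrite ge0_mule_fsumr.
Qed.

(** Atoms are selected by indicator weights, so that all sums range over the full type and can be
    compared termwise. *)
Lemma esum_pred1 (T : choiceType) (m : T) (f : T -> R) : 0 <= f m ->
  (\esum_(i in [set: T]) ((i == m)%:R * f i)%:E = (f m)%:E)%E.
Proof.
move=> f0; rewrite -(@esum_set1 R T m (fun i => (f i)%:E)) ?lee_fin//.
rewrite [RHS]esum_mkcond; apply: eq_esum => i _.
by rewrite in_set1; case: (i == m); rewrite ?mul1r ?mul0r.
Qed.

Lemma le_esum_term (T : choiceType) (m : T) (f : T -> R) :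
  (forall i, 0 <= f i) -> ((f m)%:E <= \esum_(i in [set: T]) (f i)%:E)%E.
Proof.
move=> f0; rewrite -(@esum_pred1 T m f)//; apply: le_esum => j _.
by rewrite lee_fin; case: (j == m); rewrite ?mul1r ?mul0r.
Qed.

Lemma esum_predC1 (T : choiceType) (m : T) (f : T -> R) (c : R) :
  (forall i, 0 <= f i) -> (\esum_(i in [set: T]) (f i)%:E = c%:E)%E ->
  (\esum_(i in [set: T]) ((i != m)%:R * f i)%:E = (c - f m)%:E)%E.
Proof.
move=> f0 fc.
have : (\esum_(i in [set: T]) ((i != m)%:R * f i)%:E + (f m)%:E = c%:E)%E.
  rewrite -(@esum_pred1 T m f)// -fc -esumD; last 2 first.
  - by move=> i _; rewrite lee_fin mulr_ge0.
  - by move=> i _; rewrite lee_fin mulr_ge0.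
  apply: eq_esum => i _; rewrite -EFinD -mulrDl.
  by case: (i == m); rewrite ?addr0 ?add0r mul1r.
by case: (esum _ _) => // r [<-]; rewrite addrK.
Qed.

Lemma esum_iter (T1 T2 : choiceType) (F : T1 -> T2 -> R) :
  (forall i j, 0 <= F i j) ->
  (\esum_(z in [set: T1 * T2]) (F z.1 z.2)%:E =
   \esum_(i in [set: T1]) \esum_(j in [set: T2]) (F i j)%:E)%E.
Proof.
move=> F0; rewrite esum_esum; last by move=> i j _ _; rewrite lee_fin.
by congr (esum _ _); apply/seteqP; split.
Qed.

Lemma esum_swap (T1 T2 : choiceType) (F : T1 -> T2 -> R) :
  (\esum_(z in [set: T1 * T2]) (F z.1 z.2)%:E =
   \esum_(z in [set: T2 * T1]) (F z.2 z.1)%:E)%E.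
Proof.
apply: (reindex_esum _ _ (fun z => (z.2, z.1))); split=> //.
  by move=> [i j] [k l] _ _ /= [-> ->].
by move=> [i j] _; exists (j, i).
Qed.

(** The bijection [(j, k) -> (j, j + k)] of the plane passes from the pair [(X, X')] to
    [(X, X + X')]. *)
Lemma esum_shear (F : int -> int -> R) :
  (\esum_(z in [set: int * int]) (F z.1 (z.1 + z.2)%R)%:E =
   \esum_(z in [set: int * int]) (F z.1 z.2)%:E)%E.
Proof.
symmetry; apply: (reindex_esum _ _ (fun z => (z.1, (z.1 + z.2)%R))); split=> //.
  by move=> [i j] [k l] _ _ /= [-> /addrI ->].
by move=> [i j] _; exists (i, j - i) => //=; rewrite addrC subrK.
Qed.

Lemma esum_shearr (G : int -> int -> R) :
  (\esum_(z in [set: int * int]) (G z.2 (z.1 + z.2)%R)%:E =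
   \esum_(z in [set: int * int]) (G z.1 z.2)%:E)%E.
Proof.
rewrite (esum_swap (fun j k => G k (j + k))) -[RHS]esum_shear.
by apply: eq_esum => z _; rewrite addrC.
Qed.

(** Tonelli for a kernel whose rows all have mass [c]; product laws are the case of constant
    rows. *)
Lemma esum_kernel (T1 T2 : choiceType) (f : T1 -> R) (K : T1 -> T2 -> R) (c : R) :
  0 <= c -> (forall i, 0 <= f i) -> (forall i j, 0 <= K i j) ->
  (forall i, \esum_(j in [set: T2]) (K i j)%:E = c%:E)%E ->
  (\esum_(z in [set: T1 * T2]) (f z.1 * K z.1 z.2)%:E =
   c%:E * \esum_(i in [set: T1]) (f i)%:E)%E.
Proof.
move=> c0 f0 K0 Kc.
rewrite (esum_iter (F := fun i j => f i * K i j)); last first.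
  by move=> i j; rewrite mulr_ge0.
rewrite -esumZl//.
apply: eq_esum => i _; under eq_esum do rewrite EFinM.
by rewrite esumZl ?Kc 1?muleC// => j; rewrite lee_fin.
Qed.

End nonnegative_sums.

(** * Signs relative to a median *)

Section median_sign.
Variable R : realType.

Lemma mul_bound (a b : R) : -1 <= a <= 1 -> -1 <= b <= 1 -> -1 <= a * b <= 1.
Proof. by rewrite -!ler_norml normrM => *; rewrite mulr_ile1. Qed.

Definition median_sign (m : int) (s : R) (i : int) : R :=
  if i < m then 1 else if i == m then s else -1.

Lemma median_sign_bound m (s : R) i :
  -1 <= s <= 1 -> -1 <= median_sign m s i <= 1.
Proof.
move=> s1; rewrite /median_sign; case: ltP => _; first lra.
by case: eqP => _; lra.
Qed.

(* The product over [(j, k)] of the right-hand side factorises, which makes the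
   correlation of [median_sign m s k] with the sign of [j + k] computable. *)
Lemma median_signD m (s : R) j k :
  (median_sign m s j + median_sign m s k) * median_sign (m + m) s (j + k) =
  1 + median_sign m s j * median_sign m s k
    - (1 - s ^+ 2) * ((j == m)%:R * (k == m)%:R).
Proof.
rewrite /median_sign.
(* If [j] and [k] lie strictly on opposite sides of [m], both sides are 0. Otherwise the order of
   [j + k] and [m + m] is forced. *)
have [jm|jm|->] := ltgtP j m; have [km|km|->] := ltgtP k m => /=; try (by ring).
- by rewrite (_ : (j + k < m + m)%R = true); [ring|lia].
- by rewrite (_ : (j + m < m + m)%R = true); [ring|lia].
- rewrite (_ : (j + k < m + m)%R = false); last lia.
  by rewrite (_ : (j + k == m + m)%R = false); [ring|lia].
- rewrite (_ : (j + m < m + m)%R = false); last lia.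
  by rewrite (_ : (j + m == m + m)%R = false); [ring|lia].
- by rewrite (_ : (m + k < m + m)%R = true); [ring|lia].
- rewrite (_ : (m + k < m + m)%R = false); last lia.
  by rewrite (_ : (m + k == m + m)%R = false); [ring|lia].
- by rewrite ltxx eqxx; ring.
Qed.

End median_sign.

(** * Entropy in nats *)

Section nat_entropy.
Variable R : realType.

Definition nat_entropy (f : int -> R) : \bar R :=
  (\esum_(i in [set: int]) (- (f i * ln (f i)))%:E)%E.

Lemma nat_entropy_ge0 (f : int -> R) : (forall i, 0 <= f i <= 1) ->
  (0 <= nat_entropy f)%E.
Proof. by move=> f01; apply: esum_ge0 => i _; rewrite lee_fin xlnx_ge0. Qed.

Lemma entropyE (f : int -> R) : (forall i, 0 <= f i <= 1) ->
  entropy f = ((ln 2)^-1%:E * nat_entropy f)%E.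
Proof.
move=> f01; rewrite /entropy /nat_entropy -esumZl; last 2 first.
- by rewrite invr_ge0 ln_ge0// ler1n.
- by move=> i; rewrite lee_fin xlnx_ge0.
apply: eq_esum => i _; rewrite -EFinM /log2; congr EFin; ring.
Qed.

End nat_entropy.

(** * Convolution and medians of a mass function *)

Section mass_function.
Variables (R : realType) (p : int -> R).
Hypothesis p0 : forall i, 0 <= p i.
Hypothesis p1 : (\esum_(i in [set: int]) (p i)%:E = 1)%E.

Lemma mass_le1 i : p i <= 1.
Proof.
by rewrite -lee_fin -p1 le_esum_term.
Qed.

(** The sum is at most the total mass 1, so the [fine] in [convolution] loses nothing. *)
Lemma conv_esum i :
  ((p ⋆ p) i)%:E = (\esum_(j in [set: int]) (p j * p (i - j))%:E)%E.
Proof.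
rewrite /convolution fineK// ge0_fin_numE; last first.
  by apply: esum_ge0 => j _; rewrite lee_fin mulr_ge0.
apply: (@le_lt_trans _ _ 1%E); last by rewrite ltry.
rewrite -p1; apply: le_esum => j _.
by rewrite lee_fin ler_piMr// mass_le1.
Qed.

Lemma conv_ge0 i : 0 <= (p ⋆ p) i.
Proof.
rewrite -lee_fin conv_esum; apply: esum_ge0 => j _.
by rewrite lee_fin mulr_ge0.
Qed.

Lemma conv_le1 i : (p ⋆ p) i <= 1.
Proof.
rewrite -lee_fin conv_esum -p1; apply: le_esum => j _.
by rewrite lee_fin ler_piMr// mass_le1.
Qed.

(** The product is one term of the convolution sum. Hence it vanishes wherever the convolution does,
    which makes the default value of [ln] at 0 harmless. *)
Lemma mul_mass_le_conv j k : p j * p k <= (p ⋆ p) (j + k).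
Proof.
rewrite -lee_fin conv_esum.
rewrite [X in X%:E](_ : _ = p j * p (j + k - j)); last by rewrite addrC addKr.
rewrite (le_esum_term j (f := fun i => p i * p (j + k - i)))// => i.
by rewrite mulr_ge0.
Qed.

Lemma esum_conv (phi : int -> R) : (forall i, 0 <= phi i) ->
  (\esum_(z in [set: int * int]) (p z.1 * p z.2 * phi (z.1 + z.2)%R)%:E =
   \esum_(i in [set: int]) ((p ⋆ p) i * phi i)%:E)%E.
Proof.
move=> phi0; pose F j i := p j * p (i - j) * phi i.
transitivity (\esum_(z in [set: int * int]) (F z.1 (z.1 + z.2)%R)%:E)%E.
  by apply: eq_esum => -[j k] _ /=; rewrite /F addrAC subrr add0r.
rewrite esum_shear esum_swap (esum_iter (F := fun i j => F j i)); last first.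
  by move=> i j; rewrite !mulr_ge0.
apply: eq_esum => i _; rewrite mulrC EFinM conv_esum -esumZl//; last first.
  by move=> j; rewrite lee_fin mulr_ge0.
by apply: eq_esum => j _; rewrite /F mulrC EFinM.
Qed.

Lemma esum_conv1 : (\esum_(i in [set: int]) ((p ⋆ p) i)%:E = 1)%E.
Proof.
have := @esum_conv (fun=> 1) (fun=> ler01).
under eq_esum do rewrite mulr1.
under [X in _ = X -> _]eq_esum do rewrite mulr1.
by move=> <-; rewrite (esum_kernel (K := fun=> p) ler01)// p1 mule1.
Qed.

Definition mass_below (n : int) : R :=
  fine (\esum_(i in [set: int]) ((i < n)%R%:R * p i)%:E)%E.

Lemma mass_belowE n :
  (mass_below n)%:E = (\esum_(i in [set: int]) ((i < n)%R%:R * p i)%:E)%E.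
Proof.
rewrite /mass_below fineK// ge0_fin_numE; last first.
  by apply: esum_ge0 => j _; rewrite lee_fin mulr_ge0.
apply: (@le_lt_trans _ _ 1%E); last by rewrite ltry.
rewrite -p1; apply: le_esum => j _.
by rewrite lee_fin ler_piMl// lern1 leq_b1.
Qed.

Lemma mass_belowS n : mass_below (n + 1) = mass_below n + p n.
Proof.
apply: EFin_inj; rewrite EFinD !mass_belowE -(@esum_pred1 R _ n p)//.
rewrite -esumD => [|i _|i _]; rewrite ?lee_fin ?mulr_ge0//.
apply: eq_esum => i _; rewrite -EFinD -mulrDl -natrD.
congr ((_%:R * _)%:E); lia.
Qed.

(** Some finite set [J] carries more than half of the mass. If [N] exceeds all absolute values in
    [J], then [J] lies below [N] and misses everything below [- N]. *)
Lemma mass_concentration : exists N : nat,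
  1 / 2 < mass_below N%:Z /\ mass_below (- N%:Z) <= 1 / 2.
Proof.
have : ((1 / 2)%:E < \esum_(i in [set: int]) (p i)%:E)%E.
  by rewrite p1 lte_fin; lra.
rewrite {1}/esum => /ereal_sup_gt[_ [J [finJ _] <-]].
rewrite -esum_fset//; last by move=> i _; rewrite lee_fin.
rewrite esum_mkcond => hJ.
pose N := (\max_(i <- finmap.enum_fset (fset_set J)) absz i).+1.
have JN i : i \in J -> (absz i < N)%N.
  move=> iJ; rewrite ltnS; apply: (@leq_bigmax_seq _ _ predT absz i) => //.
  by rewrite in_fset_set.
exists N; split.
  rewrite -lte_fin; apply: (lt_le_trans hJ).
  rewrite mass_belowE; apply: le_esum => i _.
  case: ifPn => [/JN iN|_]; rewrite lee_fin ?mulr_ge0//.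
  by rewrite (_ : (i < _)%R = true) ?mul1r//; lia.
have : (\esum_(i in [set: int]) (if i \in J then (p i)%:E else 0) +
        (mass_below (- N%:Z))%:E <= 1)%E.
  rewrite mass_belowE -esumD; last 2 first.
  - by move=> i _; case: ifP; rewrite ?lee_fin.
  - by move=> i _; rewrite lee_fin mulr_ge0.
  rewrite -p1; apply: le_esum => i _.
  case: ifPn => [/JN iN|_].
    by rewrite (_ : (i < _)%R = false) ?mul0r ?adde0//; lia.
  by rewrite add0e lee_fin ler_piMl// lern1 leq_b1.
move=> h.
have : ((1 / 2)%:E + (mass_below (- N%:Z))%:E <= 1)%E.
  by apply: le_trans h; rewrite leeD2r// ltW.
by rewrite -EFinD lee_fin; lra.
Qed.

(* [s] splits the atom at the median so that both sides have mass exactly 1/2. *)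
Lemma median_exists : exists (m : int) (s : R), -1 <= s <= 1 /\
  (\esum_(i in [set: int]) (p i * (1 + median_sign m s i))%:E = 1)%E.
Proof.
have [N [hN hN']] := mass_concentration.
(* The search starts at [- N], so the least threshold with more than half of the mass below it is a
   minimum over [nat]. Its predecessor is the median. *)
pose a (n : nat) : bool := 1 / 2 < mass_below (- N%:Z + n%:Z).
have exa : exists n, a n.
  by exists (N + N)%N; rewrite /a (_ : _ + _ = N%:Z)//; lia.
have [[|n] an amin] := ex_minnP exa.
  by move: an; rewrite /a addr0; lra.
pose m := - N%:Z + n%:Z.
have hm : mass_below m <= 1 / 2.
  rewrite leNgt; apply/negP => /amin; by rewrite ltnn.
have : 1 / 2 < mass_below (m + 1).
  by move: an; rewrite /a /m -addrA -PoszD addn1.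
rewrite mass_belowS => hm'.
have pm : 0 < p m by lra.
have c0 : 0 <= (1 - 2 * mass_below m) / p m by rewrite divr_ge0//; lra.
have c2 : (1 - 2 * mass_below m) / p m <= 2 by rewrite ler_pdivrMr//; lra.
(* This [s] solves [2 * mass_below m + (1 + s) * p m = 1]. *)
exists m, ((1 - 2 * mass_below m) / p m - 1); split; first by lra.
under eq_esum.
  move=> i _.
  rewrite [X in X%:E](_ : _ = 2 * ((i < m)%R%:R * p i) +
      (1 - 2 * mass_below m) / p m * ((i == m)%:R * p i)); last first.
    rewrite /median_sign; case: ltP => im.
      by rewrite lt_eqF// mul0r mulr0 addr0 !mul1r mulrC.
    by set y := _ / p m; case: eqP => _ /=; rewrite ?mulr1n ?mulr0n; ring.
  over.
rewrite /=.
under eq_esum do rewrite EFinD.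
rewrite esumD; last 2 first.
- by move=> i _; rewrite lee_fin !mulr_ge0.
- by move=> i _; rewrite lee_fin mulr_ge0// mulr_ge0.
under eq_esum do rewrite EFinM.
under [X in (_ + X)%E]eq_esum do rewrite EFinM.
rewrite !esumZl//; last 2 first.
- by move=> i; rewrite lee_fin mulr_ge0.
- by move=> i; rewrite lee_fin mulr_ge0.
rewrite esum_pred1// -mass_belowE -EFinM -EFinM -EFinD.
by congr EFin; field; rewrite gt_eqF.
Qed.

End mass_function.

(** * The two lower bounds on the entropy gain *)

Section entropy_bounds.
Variables (R : realType) (p : int -> R).
Hypothesis p0 : forall i, 0 <= p i.
Hypothesis p1 : (\esum_(i in [set: int]) (p i)%:E = 1)%E.

(** Mean zero of [sg] is expressed by nonnegative sums: [1 + sg] has mean 1, hence so does [1 - sg],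
    and [1 + c sg] is their convex combination with weights [(1 + c) / 2] and [(1 - c) / 2]. *)
Lemma esum_affine (sg : int -> R) (c : R) :
  (forall i, -1 <= sg i <= 1) -> -1 <= c <= 1 ->
  (\esum_(i in [set: int]) (p i * (1 + sg i))%:E = 1)%E ->
  (\esum_(i in [set: int]) (p i * (1 + c * sg i))%:E = 1)%E.
Proof.
move=> sg1 c1 ssg.
have sgP i : 0 <= 1 + sg i by have := sg1 i; lra.
have sgN i : 0 <= 1 - sg i by have := sg1 i; lra.
have ssgN : (\esum_(i in [set: int]) (p i * (1 - sg i))%:E = 1)%E.
  have : (1 + \esum_(i in [set: int]) (p i * (1 - sg i))%:E = 1 + 1)%E.
    rewrite -{1}ssg -esumD; last 2 first.
    - by move=> i _; rewrite lee_fin mulr_ge0.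
    - by move=> i _; rewrite lee_fin mulr_ge0.
    rewrite -p1 -esumD; last 2 first.
    - by move=> i _; rewrite lee_fin.
    - by move=> i _; rewrite lee_fin.
    by apply: eq_esum => i _; rewrite -!EFinD; congr EFin; ring.
  by case: (esum _ _) => // r [/addrI ->].
have cp : 0 <= (1 + c) / 2 by lra.
have cn : 0 <= (1 - c) / 2 by lra.
transitivity (((1 + c) / 2)%:E * 1 + ((1 - c) / 2)%:E * 1)%E; last first.
  by rewrite !mule1 -EFinD; congr EFin; field.
rewrite -{1}ssg -ssgN -!esumZl//; last 2 first.
- by move=> i; rewrite lee_fin mulr_ge0.
- by move=> i; rewrite lee_fin mulr_ge0.
rewrite -esumD; last 2 first.
- by move=> i _; rewrite -EFinM lee_fin mulr_ge0// mulr_ge0.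
- by move=> i _; rewrite -EFinM lee_fin mulr_ge0// mulr_ge0.
by apply: eq_esum => i _; rewrite -!EFinM -EFinD; congr EFin; field.
Qed.

Lemma esum_pp : (\esum_(z in [set: int * int]) (p z.1 * p z.2)%:E = 1)%E.
Proof. by rewrite (esum_kernel (K := fun=> p) ler01)// p1 mule1. Qed.

Lemma correlation_le2 (sg tau : int -> R) :
  (forall i, -1 <= sg i <= 1) -> (forall i, -1 <= tau i <= 1) ->
  (\esum_(z in [set: int * int])
     (p z.1 * p z.2 * (1 + sg z.2 * tau (z.1 + z.2)))%:E <= 2%:E)%E.
Proof.
move=> sg1 tau1.
rewrite -[leRHS]mule1 -esum_pp -esumZl//; last first.
  by move=> z; rewrite lee_fin mulr_ge0.
apply: le_esum => z _; rewrite -EFinM lee_fin mulrC ler_wpM2r ?mulr_ge0//.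
by have := mul_bound (sg1 z.2) (tau1 (z.1 + z.2)); lra.
Qed.

(** Exchanging the coordinates shows that twice the correlation is the mean of
    [(sg j + sg k) * tau (j + k)]. By [median_signD] and the zero mean of [sg], this is
    [1 - (1 - s^2) p(m)^2]. *)
Lemma correlation_ge m (s : R) : -1 <= s <= 1 ->
  (\esum_(i in [set: int]) (p i * (1 + median_sign m s i))%:E = 1)%E ->
  ((1 + (1 - p m ^+ 2) / 2)%:E <= \esum_(z in [set: int * int])
     (p z.1 * p z.2 *
       (1 + median_sign m s z.2 * median_sign (m + m) s (z.1 + z.2)))%:E)%E.
Proof.
move=> s1 ssg; set sg := median_sign m s; set tau := median_sign (m + m) s.
have sg1 i : -1 <= sg i <= 1 by exact: median_sign_bound.
have tau1 i : -1 <= tau i <= 1 by exact: median_sign_bound.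
set E := esum _ _.
have E0 z : 0 <= p z.1 * p z.2 * (1 + sg z.2 * tau (z.1 + z.2)).
  by rewrite !mulr_ge0//; have := mul_bound (sg1 z.2) (tau1 (z.1 + z.2)); lra.
have E0' z : 0 <= p z.1 * p z.2 * (1 + sg z.1 * tau (z.1 + z.2)).
  by rewrite !mulr_ge0//; have := mul_bound (sg1 z.1) (tau1 (z.1 + z.2)); lra.
have Esym : E = (\esum_(z in [set: int * int])
     (p z.1 * p z.2 * (1 + sg z.1 * tau (z.1 + z.2)))%:E)%E.
  rewrite /E (esum_swap (fun j k => p j * p k * (1 + sg k * tau (j + k)))).
  by apply: eq_esum => z _; rewrite (mulrC (p z.2)) (addrC z.2).
have Efin : E \is a fin_num.
  rewrite ge0_fin_numE; last by apply: esum_ge0 => z _; rewrite lee_fin.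
  by apply: (le_lt_trans (correlation_le2 sg1 tau1)); rewrite ltry.
have ee : (\esum_(z in [set: int * int])
    ((z.1 == m)%:R * p z.1 * ((z.2 == m)%:R * p z.2))%:E = (p m ^+ 2)%:E)%E.
  rewrite (esum_kernel (f := fun j => (j == m)%:R * p j)
     (K := fun=> fun k => (k == m)%:R * p k) (p0 m))//; last 3 first.
  - by move=> j; rewrite mulr_ge0.
  - by move=> _ j; rewrite mulr_ge0.
  - by move=> _; rewrite esum_pred1.
  by rewrite esum_pred1// -EFinM expr2.
have kk : (\esum_(z in [set: int * int])
    (p z.1 * (p z.2 * (1 + sg z.1 * sg z.2)))%:E = 1)%E.
  rewrite (esum_kernel (K := fun j k => p k * (1 + sg j * sg k)) ler01)//; last 2 first.
  - by move=> j k; rewrite mulr_ge0//; have := mul_bound (sg1 j) (sg1 k); lra.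
  - by move=> j; rewrite esum_affine.
  by rewrite p1 mule1.
(* Arranged without subtraction: 1 is the sum [kk], 2 comes from the constants in the two copies of
   [E], and the slack is [s^2 p(m)^2]. *)
have : (1 + 2%:E <= E + E + (p m ^+ 2)%:E)%E.
  rewrite {2}Esym -[2%:E]mule1 -[in X in (_ + _ * X)%E]esum_pp -esumZl//; last first.
    by move=> z; rewrite lee_fin mulr_ge0.
  have K0 z : 0 <= p z.1 * (p z.2 * (1 + sg z.1 * sg z.2)).
    by rewrite !mulr_ge0//; have := mul_bound (sg1 z.1) (sg1 z.2); lra.
  rewrite -kk -ee -!esumD; last 6 first.
  - by move=> z _; rewrite -EFinD lee_fin addr_ge0.
  - by move=> z _; rewrite lee_fin !mulr_ge0.
  - by move=> z _; rewrite lee_fin.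
  - by move=> z _; rewrite lee_fin.
  - by move=> z _; rewrite lee_fin.
  - by move=> z _; rewrite -EFinM lee_fin !mulr_ge0.
  apply: le_esum => -[j k] _ /=; rewrite -EFinM -!EFinD lee_fin.
  rewrite -subr_ge0.
  rewrite [leRHS](_ : _ = p j * p k * ((sg j + sg k) * tau (j + k)
     - 1 - sg j * sg k + (j == m)%:R * (k == m)%:R)); last by ring.
  rewrite median_signD -/sg mulr_ge0 ?mulr_ge0//.
  rewrite [leRHS](_ : _ = s ^+ 2 * ((j == m)%:R * (k == m)%:R)); last by ring.
  by rewrite mulr_ge0 ?sqr_ge0// mulr_ge0.
by rewrite -(fineK Efin) -!EFinD !lee_fin; lra.
Qed.

Let xlnx_p0 i : 0 <= - (p i * ln (p i)).
Proof. by rewrite xlnx_ge0// p0 mass_le1. Qed.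

Let lnq0 i : 0 <= - ln ((p ⋆ p) i).
Proof. by rewrite oppr_ge0 ln_le0// conv_le1. Qed.

Lemma esum_pp_lnq :
  (\esum_(z in [set: int * int])
    (p z.1 * p z.2 * - ln ((p ⋆ p) (z.1 + z.2)))%:E = nat_entropy (p ⋆ p))%E.
Proof.
rewrite (esum_conv p0 p1 (phi := fun i => - ln ((p ⋆ p) i)))//.
by apply: eq_esum => i _; rewrite mulrN.
Qed.

(** Sums [ln_chord_le] over all pairs, with [u = p j], [v = q (j + k)], [s = sg k * tau (j + k)] and
    weight [p k]. *)
Lemma median_entropy_gain m (s h : R) : -1 <= s <= 1 ->
  (\esum_(i in [set: int]) (p i * (1 + median_sign m s i))%:E = 1)%E ->
  nat_entropy p = h%:E ->
  ((h + ((1 - p m ^+ 2) / 2) ^+ 2 / 2)%:E <= nat_entropy (p ⋆ p))%E.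
Proof.
move=> s1 ssg hE; have := correlation_ge s1 ssg.
set sg := median_sign m s; set tau := median_sign (m + m) s.
have sg1 i : -1 <= sg i <= 1 by exact: median_sign_bound.
have tau1 i : -1 <= tau i <= 1 by exact: median_sign_bound.
set d := (1 - p m ^+ 2) / 2; set E := esum _ _ => hcor.
have pm2 : 0 <= p m ^+ 2 <= 1 by rewrite sqr_ge0 expr_le1// ?mass_le1.
have d0 : 0 <= d by rewrite /d; lra.
have d1 : d < 1 by rewrite /d; lra.
have := binary_entropy_quadratic d0 d1.
have lnp : 0 <= ln (1 + d) by rewrite ln_ge0//; lra.
have lnmp : ln (1 - d) <= - ln (1 + d).
  have : ln (1 - d) <= - d by apply: le_ln1Dx; lra.
  have : ln (1 + d) <= d by apply: le_ln1Dx; lra.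
  lra.
(* The chord is [a + b s]. It is written as [b (1 + s) - (b - a)] so that, after transposition, only
   nonnegative sums occur. *)
pose b := (ln (1 + d) - ln (1 - d)) / 2.
pose a := (ln (1 + d) + ln (1 - d)) / 2.
have b0 : 0 <= b by rewrite /b; lra.
have ba0 : 0 <= b - a by rewrite /a /b; lra.
move=> quad.
have st1 (j k : int) : -1 <= sg k * tau j <= 1 by exact: mul_bound.
have dst1 (j k : int) : -1 <= d * (sg k * tau j) <= 1.
  by apply: mul_bound => //; lra.
pose q := p ⋆ p.
have q0 i : 0 <= q i by exact: conv_ge0.
have : (h%:E + 1 + b%:E * E <= nat_entropy q + (b - a)%:E * 1 + 1)%E.
  have -> : h%:E = (\esum_(z in [set: int * int])
      (- (p z.1 * ln (p z.1)) * p z.2)%:E)%E.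
    by rewrite (esum_kernel (f := fun j => - (p j * ln (p j)))
      (K := fun=> p) ler01)// mul1e.
  (* For a fixed value [i] of the sum, the factor next to [q i] has total mass 1 in [k], because
     [sg] has mean zero. *)
  have {3}-> : 1%E = (\esum_(z in [set: int * int])
      (q (z.1 + z.2) * (p z.2 * (1 + d * (sg z.2 * tau (z.1 + z.2)))))%:E)%E.
    rewrite (esum_shearr (fun k i => q i * (p k * (1 + d * (sg k * tau i))))).
    rewrite (esum_swap (fun k i => q i * (p k * (1 + d * (sg k * tau i))))).
    rewrite (esum_kernel (f := q)
      (K := fun i k => p k * (1 + d * (sg k * tau i))) ler01)//; last 2 first.
    - by move=> i k; rewrite mulr_ge0//; have := dst1 i k; lra.
    - move=> i; under eq_esum do rewrite (mulrC (sg _)) mulrA.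
      by rewrite esum_affine// mul_bound//; lra.
    by rewrite esum_conv1// mul1e.
  have E0 z : 0 <= p z.1 * p z.2 * (1 + sg z.2 * tau (z.1 + z.2)).
    by rewrite !mulr_ge0//; have := st1 (z.1 + z.2) z.2; lra.
  have D0 z : 0 <= q (z.1 + z.2) * (p z.2 * (1 + d * (sg z.2 * tau (z.1 + z.2)))).
    by rewrite !mulr_ge0//; have := dst1 (z.1 + z.2) z.2; lra.
  rewrite -{1 2}esum_pp -esum_pp_lnq /E -!esumZl//; last first.
    by move=> z; rewrite lee_fin mulr_ge0.
  rewrite -!esumD; last 8 first.
  - by move=> z _; rewrite -EFinM -EFinD lee_fin addr_ge0 ?mulr_ge0.
  - by move=> z _; rewrite lee_fin.
  - by move=> z _; rewrite lee_fin !mulr_ge0.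
  - by move=> z _; rewrite -EFinM lee_fin mulr_ge0 ?mulr_ge0.
  - by move=> z _; rewrite -EFinD lee_fin addr_ge0 ?mulr_ge0.
  - by move=> z _; rewrite -EFinM lee_fin mulr_ge0.
  - by move=> z _; rewrite lee_fin mulr_ge0.
  - by move=> z _; rewrite lee_fin mulr_ge0.
  apply: le_esum => -[j k] _ /=; rewrite -!EFinM -!EFinD lee_fin.
  have := mul_mass_le_conv p0 p1 j k; rewrite -/q.
  set t := sg k * tau (j + k).
  (* Where [q] vanishes, so does [p j * p k], and both sides are 0. *)
  have := q0 (j + k); rewrite le_eqVlt => /predU1P[<- pp0|qjk _].
    have {}pp0 : p j * p k = 0 by apply/eqP; rewrite eq_le pp0 mulr_ge0.
    by rewrite mulNr mulrAC pp0; lra.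
  have := ler_wpM2l (p0 k) (ln_chord_le d0 d1 (st1 (j + k) k) (p0 j) qjk).
  rewrite -/t -subr_ge0 => hc; rewrite -subr_ge0; move: hc.
  by congr (0 <= _); rewrite /a /b; field.
have : (0%E <= nat_entropy q)%E.
  by apply: nat_entropy_ge0 => i; rewrite q0 conv_le1//.
move: hcor quad; rewrite -/q.
have : (E <= 2%:E)%E := correlation_le2 sg1 tau1.
case: E => [e| |]//; rewrite !lee_fin => _ he quad.
case: (nat_entropy q) => [k _| |]//; last by move=> *; rewrite leey.
rewrite -!EFinM -!EFinD !lee_fin => hk.
(* At correlation [d] the chord equals [a + b d], half of the quantity bounded in
   [binary_entropy_quadratic]. *)
have : b * (1 + d) <= b * e by rewrite ler_wpM2l.
have : d * b + a = ((1 + d) * ln (1 + d) + (1 - d) * ln (1 - d)) / 2.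
  by rewrite /a /b; field.
lra.
Qed.

(** Given [X' = m], the sum is a translate of [X] and has entropy [h]. Given [X' <> m], its entropy
    is at least that of [X']. By the chain rule the average is [h + p(m) h] minus the binary entropy
    of [p(m)]. *)
Lemma atom_entropy_gain m (h : R) : nat_entropy p = h%:E ->
  ((h + p m * h + p m * ln (p m) + (1 - p m) * ln (1 - p m))%:E
    <= nat_entropy (p ⋆ p))%E.
Proof.
move=> hE; set u := 1 - p m.
have u0 : 0 <= u by rewrite subr_ge0 mass_le1.
have u1 : u <= 1 by rewrite /u; have := p0 m; lra.
have lnu0 : 0 <= - ln u by rewrite oppr_ge0 ln_le0.
pose e (k : int) : R := (k == m)%:R.
pose e' (k : int) : R := (k != m)%:R.
have e0 k : 0 <= e k by [].
have e0' k : 0 <= e' k by [].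
pose q := p ⋆ p.
have q0 i : 0 <= q i by exact: conv_ge0.
have se : (\esum_(k in [set: int]) (e k * p k)%:E = (p m)%:E)%E.
  by rewrite esum_pred1.
have se' : (\esum_(k in [set: int]) (e' k * p k)%:E = u%:E)%E.
  by rewrite (esum_predC1 m p0 p1).
have : ((p m)%:E * h%:E + (h - - (p m * ln (p m)))%:E + 1 <=
    nat_entropy q + (p m)%:E + (- ln u)%:E * u%:E + u%:E)%E.
  have -> : ((p m)%:E * h%:E = \esum_(z in [set: int * int])
      (- (p z.1 * ln (p z.1)) * (e z.2 * p z.2))%:E)%E.
    rewrite (esum_kernel (f := fun j => - (p j * ln (p j)))
      (K := fun=> fun k => e k * p k) (p0 m))//; last by move=> *; rewrite mulr_ge0.
    by rewrite -hE.
  have -> : ((h - - (p m * ln (p m)))%:E = \esum_(z in [set: int * int])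
      (e' z.2 * - (p z.2 * ln (p z.2)) * p z.1)%:E)%E.
    rewrite (esum_swap (fun j k => e' k * - (p k * ln (p k)) * p j)).
    rewrite (esum_kernel (f := fun k => e' k * - (p k * ln (p k)))
      (K := fun=> p) ler01)//; last by move=> *; rewrite mulr_ge0.
    by rewrite mul1e (esum_predC1 m (f := fun k => - (p k * ln (p k))) _ hE).
  have -> : ((p m)%:E = \esum_(z in [set: int * int])
      (e z.2 * p z.2 * q (z.1 + z.2))%:E)%E.
    rewrite (esum_shearr (fun k i => e k * p k * q i)).
    rewrite (esum_kernel (f := fun k => e k * p k) (K := fun=> q) ler01)//.
    - by rewrite se mul1e.
    - by move=> *; rewrite mulr_ge0.
    - by move=> _; exact: esum_conv1.
  have -> : ((- ln u)%:E * u%:E = \esum_(z in [set: int * int])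
      (- ln u * (p z.1 * (e' z.2 * p z.2)))%:E)%E.
    under eq_esum do rewrite EFinM.
    rewrite esumZl//; last by move=> *; rewrite lee_fin !mulr_ge0.
    rewrite (esum_kernel (K := fun=> fun k => e' k * p k) u0)//.
    - by rewrite p1 mule1.
    - by move=> *; rewrite mulr_ge0.
  (* This sum keeps the row [k = m]; its terms are nonnegative and stand on the larger side. *)
  have -> : (u%:E = \esum_(z in [set: int * int])
      (u * (p z.1 * q (z.1 + z.2)))%:E)%E.
    under eq_esum do rewrite EFinM.
    rewrite esumZl//; last by move=> *; rewrite lee_fin !mulr_ge0.
    rewrite (esum_shear (fun j i => p j * q i)).
    rewrite (esum_kernel (f := p) (K := fun=> q) ler01)//.
    - by rewrite p1 !mule1.
    - by move=> _; exact: esum_conv1.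
  rewrite -esum_pp -esum_pp_lnq.
  have n1 z : 0 <= - (p z.1 * ln (p z.1)) * (e z.2 * p z.2).
    by rewrite !mulr_ge0.
  have n2 z : 0 <= e' z.2 * - (p z.2 * ln (p z.2)) * p z.1.
    by rewrite !mulr_ge0.
  have n3 (z : int * int) : 0 <= p z.1 * p z.2 by rewrite mulr_ge0.
  have n4 z : 0 <= p z.1 * p z.2 * - ln (q (z.1 + z.2)) by rewrite !mulr_ge0.
  have n5 z : 0 <= e z.2 * p z.2 * q (z.1 + z.2) by rewrite !mulr_ge0.
  have n6 z : 0 <= - ln u * (p z.1 * (e' z.2 * p z.2)) by rewrite !mulr_ge0.
  have n7 z : 0 <= u * (p z.1 * q (z.1 + z.2)) by rewrite !mulr_ge0.
  rewrite -!esumD; do ?by move=> z _; rewrite -?EFinD lee_fin ?addr_ge0.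
  apply: le_esum => -[j k] _ /=; rewrite -!EFinD lee_fin.
  have := mul_mass_le_conv p0 p1 j k; rewrite -/q.
  have := q0 (j + k); rewrite le_eqVlt => /predU1P[<- pp0|qjk _].
    have /eqP : p j * p k = 0 by apply/eqP; rewrite eq_le pp0 mulr_ge0.
    by rewrite mulf_eq0 => /orP[] /eqP ->; lra.
  (* For [k = m], Gibbs compares [p j] with [q (j + m)]. For [k <> m], it compares [p k] with
     [u q (j + k)]; the factor [u] produces the term [- ln u]. *)
  rewrite /e /e'; have [km|km] := eqVneq k m.
    rewrite km in qjk *.
    have := ler_wpM2l (p0 m) (xlnx_le (p0 j) qjk).
    have : 0 <= u * (p j * q (j + m)) by rewrite !mulr_ge0.
    rewrite mul1r !mul0r; lra.
  have pku : p k <= u.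
    rewrite -lee_fin -se' -[p k]mul1r (_ : 1 = e' k); last by rewrite /e' km.
    rewrite (le_esum_term k (f := fun k => e' k * p k))// => i.
    by rewrite mulr_ge0.
  (* If [u = 0], then [p k = 0] off the atom, so the default value of [ln u] has no effect. *)
  have := u0; rewrite le_eqVlt => /predU1P[uE|u0'].
    have -> : p k = 0 by apply/eqP; rewrite eq_le p0 uE pku.
    have : 0 <= u * (p j * q (j + k)) by rewrite !mulr_ge0.
    rewrite !(mul0r, mulr0); lra.
  have := ler_wpM2l (p0 j) (xlnx_le (p0 k) (mulr_gt0 u0' qjk)).
  rewrite lnM ?posrE// !mul1r !mul0r; lra.
have : (0%E <= nat_entropy q)%E.
  by apply: nat_entropy_ge0 => i; rewrite q0 conv_le1.
rewrite -/q; case: (nat_entropy q) => [k _| |]//; last by move=> *; rewrite leey.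
rewrite -!EFinM -!EFinD !lee_fin; rewrite /u; lra.
Qed.

End entropy_bounds.

(** * The rational profile of the gap function *)

Section gap.
Variable R : realType.
Implicit Types c t : R.

(* The threshold for [t = sqrt (1 - x)] that balances the two entropy bounds:
   [(1 - saturation h) * h = 4 * saturation h]. *)
Definition saturation c := c / (c + 4).

Lemma saturation_le1 c : 0 <= c -> 0 <= saturation c <= 1.
Proof.
move=> c0; rewrite /saturation divr_ge0 ?addr_ge0//=.
by rewrite ler_pdivrMr; lra.
Qed.

Lemma saturation_homo c c' : 0 <= c -> c <= c' -> saturation c <= saturation c'.
Proof.
move=> c0 cc'; rewrite /saturation ler_pdivrMr; last by lra.
by rewrite mulrAC ler_pdivlMr; lra.
Qed.

Lemma saturation_eq0 c : 0 <= c -> saturation c = 0 <-> c = 0.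
Proof.
move=> c0; split=> [/eqP|->]; last by rewrite /saturation mul0r.
by rewrite mulf_eq0 invr_eq0 => /orP[/eqP//|/eqP]; lra.
Qed.

Lemma saturation_cvg : saturation c @[c --> +oo] --> (1 : R).
Proof.
suff h : (1 - 4 * (c + 4)^-1) @[c --> +oo] --> (1 : R).
  apply: cvg_trans h; apply: near_eq_cvg; near=> c.
  have c0 : 0 < c by near: c; exact: nbhs_pinfty_gt.
  by rewrite /saturation; field; rewrite gt_eqF//; lra.
rewrite -[X in _ --> X](subr0 1) -(mulr0 4).
apply: cvgB; first exact: cvg_cst.
apply: cvgM; first exact: cvg_cst.
apply/gtr0_cvgV0; last exact: cvg_addrr.
near=> c.
have c0 : 0 < c by near: c; exact: nbhs_pinfty_gt.
by rewrite addr_gt0.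
Unshelve. all: by end_near. Qed.

End gap.

(** * Combination of the two bounds *)

Section entropy_gap.
Variables (R : realType) (p : int -> R).
Hypothesis p0 : forall i, 0 <= p i.
Hypothesis p1 : (\esum_(i in [set: int]) (p i)%:E = 1)%E.

Lemma entropy_gap (h : R) : nat_entropy p = h%:E ->
  ((h + saturation h ^+ 4 / 8)%:E <= nat_entropy (p ⋆ p))%E.
Proof.
move=> hE.
have h0 : 0 <= h.
  rewrite -lee_fin -hE; apply: nat_entropy_ge0 => i.
  by rewrite p0 mass_le1.
have [m [s [s1 ssg]]] := median_exists p0 p1.
have x1 := mass_le1 p0 p1 m; have x0 := p0 m.
pose t := Num.sqrt (1 - p m).
have t0 : 0 <= t by exact: sqrtr_ge0.
have tt : t ^+ 2 = 1 - p m by rewrite sqr_sqrtr// subr_ge0.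
have t1 : t <= 1 by rewrite -(expr_le1 (n := 2))// tt; lra.
have /andP[c0 c1] := saturation_le1 h0; set c := saturation h in c0 c1 *.
have [ct|tc] := leP c t.
  apply: le_trans (median_entropy_gain p0 p1 s1 ssg hE).
  rewrite lee_fin lerD2l.
  (* Here [1 - p(m)^2 >= 1 - p(m) = t^2 >= c^2]. *)
  have : c ^+ 4 <= (1 - p m ^+ 2) ^+ 2.
    rewrite (exprM c 2 2); apply: lerXn2r; rewrite ?nnegrE ?sqr_ge0//.
      by rewrite subr_ge0 expr_le1.
    apply: (@le_trans _ _ (t ^+ 2)); first by rewrite lerXn2r ?nnegrE.
    by rewrite tt lerD2l lerN2 expr2 ler_piMr.
  by rewrite expr_div_n; lra.
(* For [t < c] the gain is at least [(1 - t) h - 3 t >= (1 - c) h - 3 c = c], which exceeds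
   [c^4 / 8] or equals it. *)
apply: le_trans (atom_entropy_gain p0 p1 m hE); rewrite lee_fin.
have t01 : 0 <= t <= 1 by rewrite t0.
have := binary_entropy_le x0 t01 tt.
have -> : p m = 1 - t ^+ 2 by rewrite tt; ring.
have tt' : t ^+ 2 <= t by rewrite expr2 ler_piMr.
have := ler_wpM2r h0 (_ : 1 - t <= 1 - t ^+ 2).
have hc : (1 - c) * h = 4 * c by rewrite /c /saturation; field; rewrite gt_eqF//; lra.
have : (1 - c) * h <= (1 - t) * h by rewrite ler_wpM2r//; lra.
have : c ^+ 4 <= c by rewrite exprS ler_piMr// exprn_ile1.
move=> a1 a2 /(_ ltac:(lra)) a3 a4.
lra.
Qed.

End entropy_gap.

(** * From random variables to mass functions, and the theorem *)

Lemma has_distribution_ge0 (d : measure_display) (T : measurableType d)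
    (R : realType) (P : probability T R) (X : {RV P >-> int}) (p : int -> R) :
  has_distribution X p -> forall i, 0 <= p i.
Proof. by move=> Xp i; rewrite -lee_fin -Xp measure_ge0. Qed.

(** Countable additivity is indexed by [nat], so the integers are split into the fibres of the
    injection [pickle], which are singletons. *)
Lemma has_distribution_esum1 (d : measure_display) (T : measurableType d)
    (R : realType) (P : probability T R) (X : {RV P >-> int}) (p : int -> R) :
  has_distribution X p -> (\esum_(i in [set: int]) (p i)%:E = 1)%E.
Proof.
move=> Xp; rewrite -(probability_setT (distribution P X)).
rewrite (_ : [set: int] = \bigcup_(n in range (@pickle int))
    (@pickle int @^-1` [set n])); last first.
  by apply/seteqP; split=> // i _; exists (pickle i) => //; exists i.
rewrite measure_bigcup//=; last first.
  by move=> n n' _ _ [i [/= <- <-]].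
rewrite nneseries_esum; last by move=> n _; exact: measure_ge0.
rewrite (reindex_esum [set: int] _ pickle); last first.
  split=> //.
  - by move=> i _ /=; rewrite inE; exists i.
  - by move=> n /=; rewrite inE => -[i _ <-]; exists i.
rewrite (_ : \bigcup_(n in _) _ = [set: int]); last first.
  by apply/seteqP; split=> // i _; exists (pickle i) => //; exists i.
apply: eq_esum => i _; rewrite -Xp; congr (distribution P X _).
by apply/seteqP; split=> [j ->//|j /= /(pcan_inj pickleK)].
Qed.

Theorem theorem1 (R : realType) :
  exists g : R -> R,
    (forall c : R, 0 <= c -> 0 <= g c) /\
    (forall (d : measure_display) (T : measurableType d) (P : probability T R)
        (X X' : {RV P >-> int}) (p : int -> R),
      independent_RVs X X' ->
      has_distribution X p -> has_distribution X' p ->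
      (entropy p < +oo)%E ->
      ((g (fine (entropy p)))%:E <= entropy (p ⋆ p) - entropy p)%E) /\
    (forall c c' : R, 0 <= c -> c <= c' -> g c <= g c') /\
    (g c @[c --> +oo] --> 8^-1 * log2 (expR 1)) /\
    (forall c : R, 0 <= c -> (g c = 0 <-> c = 0)).
Proof.
have ln2 : 0 < ln 2 :> R by rewrite ln_gt0// ltr1n.
have K0 : 0 < 8^-1 / ln 2 :> R by rewrite divr_gt0.
have nat0 (c : R) : 0 <= c -> 0 <= ln 2 * c by move=> c0; rewrite mulr_ge0// ltW.
(* The factor [ln 2] inside converts bits to nats and the division by [ln 2] converts back. The
   limit is right because [log2 (expR 1)] is [1 / ln 2]. *)
exists (fun c => 8^-1 / ln 2 * saturation (ln 2 * c) ^+ 4).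
split.
  move=> c c0; rewrite mulr_ge0 ?(ltW K0)// exprn_ge0//.
  by have /andP[] := saturation_le1 (nat0 _ c0).
split.
  move=> d T P X X' p _ Xp _.
  have p0 := has_distribution_ge0 Xp; have p1 := has_distribution_esum1 Xp.
  rewrite !entropyE; last 2 first.
  - by move=> i; rewrite conv_ge0// conv_le1.
  - by move=> i; rewrite p0 mass_le1.
  have : (0 <= nat_entropy p)%E.
    by apply: nat_entropy_ge0 => i; rewrite p0 mass_le1.
  have := entropy_gap p0 p1.
  case: (nat_entropy p) => [h /(_ h erefl)| |]//; last first.
    by rewrite gt0_muley// lte_fin invr_gt0.
  move=> gap _ _; rewrite -EFinM leeBrDr//= mulVKf ?gt_eqF//.
  have iln2 : (0 <= (ln 2)^-1%:E :> \bar R)%E by rewrite lee_fin invr_ge0 ltW.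
  apply: le_trans (lee_wpmul2l iln2 gap).
  rewrite -EFinD -EFinM lee_fin le_eqVlt; apply/orP; left; apply/eqP.
  by field; rewrite gt_eqF.
split.
  move=> c c' c0 cc'; rewrite ler_wpM2l ?(ltW K0)// lerXn2r// ?nnegrE.
  - by have /andP[] := saturation_le1 (nat0 _ c0).
  - by have /andP[] := saturation_le1 (nat0 _ (le_trans c0 cc')).
  - by rewrite saturation_homo ?nat0// ler_wpM2l// ltW.
split.
  rewrite /log2 expRK mul1r -[X in _ --> X]mulr1.
  apply: cvgM; first exact: cvg_cst.
  have h : saturation (ln 2 * c) @[c --> +oo] --> (1 : R).
    apply: (cvg_comp _ _ _ (@saturation_cvg R)).
    exact: (gt0_cvgMry ln2 cvg_id).
  rewrite -[X in _ --> X](expr1n R 4).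
  apply: (cvg_comp (fun c => saturation (ln 2 * c)) (fun x : R => x ^+ 4) h).
  exact: exprn_continuous.
move=> c c0; split=> [/eqP|->]; last first.
  by rewrite mulr0 /saturation mul0r expr0n mulr0.
rewrite mulf_eq0 (gt_eqF K0)/= expf_eq0/= => /eqP.
move=> /(saturation_eq0 (nat0 _ c0))/eqP.
by rewrite mulf_eq0 gt_eqF//= => /eqP.
Qed.
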